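(* For all positive integers $r$ and $k$ with $r\geq 3$, we have $m(r,k)\geq 1-\left(\frac{r-1}{r}\right)^k$.
   Context: For a graph $G$ and $S\subseteq V(G)$, $\partial S$ denotes the set of edges of $G$ with exactly one end in $S$. For a positive integer $r$, an $r$-graph is an $r$-regular graph $G$ such that $|\partial S|\geq r$ for every $S\subseteq V(G)$ of odd cardinality. A 1-factor is a perfect matching. For an $r$-graph $G$ with set $\mathcal{M}$ of 1-factors and a positive integer $k$, define $m(r,k,G)=\max_{M_1,\ldots,M_k\in\mathcal{M}} \frac{|\bigcup_{i=1}^k M_i|}{|E(G)|}$ (the $M_i$ need not be distinct), and $m(r,k)=\inf_G m(r,k,G)$, the infimum taken over all $r$-graphs $G$. *)

(* Defs.v *)
From HB Require Import structures.
From mathcomp Require Import all_boot all_order all_algebra.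
From mathcomp Require Import all_classical all_reals.

Set Implicit Arguments.
Unset Strict Implicit.
Unset Printing Implicit Defensive.

Import Order.TTheory GRing.Theory Num.Theory.
Local Open Scope ring_scope.

(* Finite graphs with parallel edges allowed.  Loops are left out: a vertex v
   of degree r carrying a loop has fewer than r edges in the cut of [set v],
   hence never occurs in an r-graph.  Vertex sets are nonempty, so that an
   r-graph with r > 0 has an edge and the ratio in [cover_ratio] is genuine. *)
Record graph := Graph {
  vertex : finType;
  edge : finType;
  ends : edge -> {set vertex};
  vertex_gt0 : (0 < #|vertex|)%N;
  card_ends : forall e, #|ends e| = 2%N
}.

Definition incident (G : graph) (v : vertex G) : {set edge G} :=
  [set e | v \in ends e]%SET.

Definition boundary (G : graph) (S : {set vertex G}) : {set edge G} :=
  [set e | #|ends e :&: S| == 1%N]%SET.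

Definition regular (r : nat) (G : graph) : Prop :=
  forall v : vertex G, #|incident v| = r.

Definition r_graph (r : nat) (G : graph) : Prop :=
  regular r G /\
  forall S : {set vertex G}, odd #|S| -> (r <= #|boundary S|)%N.

Definition one_factor (G : graph) (M : {set edge G}) : bool :=
  [forall v : vertex G, #|incident v :&: M|%SET == 1%N].

(* m(r,k,G).  The ratios are nonnegative, so the default value 0 of the
   iterated maximum does not alter it when G has a 1-factor. *)
Definition cover_ratio (R : realType) (k : nat) (G : graph) : R :=
  \big[Num.max/0]_(M : {ffun 'I_k -> {set edge G}} |
                     [forall i, one_factor (M i)])
    (#|(\bigcup_(i < k) M i)%SET|%:R / #|edge G|%:R).

(* m(r,k).  The set is bounded below by 0, and for r > 0 it is nonempty (two
   vertices joined by r parallel edges), so [inf] is its infimum and not the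
   default value 0. *)
Definition min_cover_ratio (R : realType) (r k : nat) : R :=
  inf [set x : R | exists2 G : graph, r_graph r G & x = cover_ratio R k G]%classic.

(* Main.v *)
(* The constant weight 1/r lies in the perfect matching polytope of an r-graph,
   so by Edmonds' theorem every edge set U meets some 1-factor in at least |U|/r
   edges.  Choosing greedily, with U the set of edges not yet covered, each
   1-factor reduces the uncovered part by a factor (r-1)/r.

   Edmonds' theorem is proved by induction on the number of vertices and the size
   of the support of x.  If some odd cut with at least three vertices on both
   sides is tight, contract either side and glue the matchings along one edge of
   the cut.  Otherwise x is integral, or it can be moved in a direction y that
   preserves all degrees until an edge drops out of the support or such a cut
   becomes tight.  The direction y exists by counting dimensions unless the
   fractional edges form a 2-regular graph, and then it exists unless that graph
   has an odd component, which violates the cut condition. *)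
Require Import Defs.
From HB Require Import structures.
From mathcomp Require Import all_boot all_order all_algebra.
From mathcomp Require Import all_classical all_reals.
From mathcomp Require Import zify ring lra.

Set Implicit Arguments.
Unset Strict Implicit.
Unset Printing Implicit Defensive.

Import Order.TTheory GRing.Theory Num.Theory.
Local Open Scope ring_scope.

(** * Balanced edge weights *)

(** Fewer equations than unknowns: the coefficient matrix restricted to [P] and [Q] has a nonzero
    kernel vector, which is extended by 0 outside [Q]. *)
Lemma underdetermined_kernel (F : fieldType) (I J : finType)
    (P : {set I}) (Q : {set J}) (c : I -> J -> F) : (#|P| < #|Q|)%N ->
  exists z : J -> F, [/\ exists j, z j != 0, forall j, j \notin Q -> z j = 0
    & forall i, i \in P -> \sum_j c i j * z j = 0].
Proof.
move=> ltPQ.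
(* Unknowns index the rows, since [kermx] is the left kernel. *)
pose M := \matrix_(j < #|Q|, i < #|P|) c (enum_val i) (enum_val j).
have : kermx M != 0.
  rewrite -mxrank_eq0 mxrank_ker subn_eq0 -ltnNge.
  exact: leq_ltn_trans (rank_leq_col M) ltPQ.
case/rowV0Pn => v /sub_kermxP vM /rV0Pn[j0 vj0].
have [q0 q0Q] : exists q, q \in Q by exists (enum_val j0); apply: enum_valP.
pose z j := if j \in Q then v 0 (enum_rank_in q0Q j) else 0.
have zv k : z (enum_val k) = v 0 k.
  by rewrite /z enum_valP enum_valK_in.
exists z; split; first by exists (enum_val j0); rewrite zv.
  by move=> j /negbTE; rewrite /z => ->.
move=> i iP; have /matrixP/(_ 0 (enum_rank_in iP i)) := vM.
rewrite !mxE => E0; rewrite -[RHS]E0 (bigID (mem Q)) /= [X in _ + X]big1 ?addr0.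
  rewrite big_enum_val /=; apply: eq_bigr => k _.
  by rewrite zv !mxE enum_rankK_in // mulrC.
by move=> j /negbTE jQ; rewrite /z jQ mulr0.
Qed.

(** Unordered pairs, so that each edge of a symmetric [e] is one unknown and not two. *)
Definition edge_set (V : finType) (e : rel V) : {set {set V}} :=
  [set [set p.1; p.2] | p : V * V & e p.1 p.2]%SET.

Lemma edge_setP (V : finType) (e : rel V) (P : {set V}) :
  reflect (exists u v, e u v /\ P = [set u; v]%SET) (P \in edge_set e).
Proof.
apply: (iffP imsetP) => [[[u v] /=]|[u [v [euv ->]]]].
  by rewrite inE /= => euv ->; exists u, v.
by exists (u, v); rewrite ?inE.
Qed.

Lemma set2_inj (V : finType) (u : V) : injective (fun v : V => [set u; v]%SET).
Proof.
move=> v w E.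
have : v \in [set u; w]%SET by rewrite -E set22.
have : w \in [set u; v]%SET by rewrite E set22.
by rewrite !inE => /orP[] /eqP ? /orP[] /eqP ?; subst.
Qed.

(** Double counting of incidences: the neighbours [u] of [v] correspond to the edges at [v] through
    [[set v; u]]. *)
Lemma handshake (V : finType) (e : rel V) : symmetric e -> irreflexive e ->
  (\sum_v #|[set u | e v u]| = 2 * #|edge_set e|)%N.
Proof.
move=> esym eirr.
have -> : (2 * #|edge_set e| = \sum_(P in edge_set e) #|P|)%N.
  rewrite mulnC -sum_nat_const; apply: eq_bigr => P /edge_setP[u [v [euv ->]]].
  by rewrite cards2; case: eqP euv => // ->; rewrite eirr.
under [RHS]eq_bigr do rewrite -sum1_card.
rewrite (exchange_big_dep predT) //=; apply: eq_bigr => v _.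
rewrite sum1_card -(card_in_imset (f := fun u => [set v; u]%SET));
  last by move=> ? ? _ _; apply: set2_inj.
apply: eq_card => P; rewrite unfold_in /=; apply/imsetP/andP.
  case=> u; rewrite inE => evu ->; split; last by rewrite set21.
  by apply/edge_setP; exists v, u.
case=> /edge_setP[a [b [eab ->]]]; rewrite !inE => /orP[]/eqP->.
  by exists b; rewrite ?inE.
by exists a; rewrite ?inE 1?esym // finset.setUC.
Qed.

Lemma sumr_eq0_signs (F : realDomainType) (I : finType) (g : I -> F) i :
  \sum_j g j = 0 -> g i != 0 ->
  (exists j, 0 < g j) /\ (exists j, g j < 0).
Proof.
move=> g0 gi; split; apply: contrapT => H.
- have gle j : 0 <= - g j.
    by rewrite oppr_ge0 leNgt; apply/negP => ?; apply: H; exists j.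
  have : \sum_j - g j = 0 by rewrite sumrN g0 oppr0.
  move/psumr_eq0P => /(_ (fun j _ => gle j)) /(_ i isT)/eqP.
  by rewrite oppr_eq0 (negbTE gi).
- have gle j : 0 <= g j.
    by rewrite leNgt; apply/negP => ?; apply: H; exists j.
  by move/psumr_eq0P: g0 => /(_ (fun j _ => gle j)) /(_ i isT)/eqP; rewrite (negbTE gi).
Qed.

Definition edge_weight (F : realFieldType) (V : finType) (e : rel V)
    (y : V -> V -> F) :=
  [/\ forall u v, y u v = y v u, forall u v, y u v != 0 -> e u v
    & exists u v, y u v != 0].

Lemma sum_sgr (F : realDomainType) (I : finType) (g : I -> F) :
  \sum_i Num.sg (g i) = #|[set i | 0 < g i]%SET|%:R - #|[set i | g i < 0]%SET|%:R.
Proof.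
rewrite -!sum1_card !natr_sum 2![\sum_(i in [set _ | _]%SET) _]big_mkcond -sumrB /=.
apply: eq_bigr => i _; rewrite !inE.
by case: sgrP => _; rewrite ?subrr ?subr0 ?sub0r.
Qed.

(* If the row sum at [v0] is nonzero, every other vertex meeting the support of
   [y] has exactly one positive and one negative edge.  By the handshake lemma
   for both signs, either the same holds at [v0], and the signs of [y] are
   balanced, or the support of [y] spans an odd closed set. *)
Lemma balanced_weight_two_regular (F : realFieldType) (V : finType) (e : rel V)
    (y : V -> V -> F) (v0 : V) :
  symmetric e -> irreflexive e -> (forall v, #|[set u | e v u]%SET| <= 2)%N ->
  edge_weight e y -> (forall v, v != v0 -> \sum_u y v u = 0) ->
  (exists2 y' : V -> V -> F, edge_weight e y' & forall u, \sum_v y' u v = 0) \/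
  (exists K : {set V}, [/\ odd #|K|, forall u v, u \in K -> e u v -> v \in K
     & forall u, u \in K -> exists v, e u v]).
Proof.
move=> esym eirr deg2 [ysym ye [a [b yab]]] row0.
have [rowv0|rowv0] := eqVneq (\sum_u y v0 u) 0.
  left; exists y; first by split => //; exists a, b.
  by move=> u; have [->|/row0] := eqVneq u v0.
pose pos v := [set u | 0 < y v u]%SET; pose neg v := [set u | y v u < 0]%SET.
pose supp v := [set u | y v u != 0]%SET.
pose K := [set v | [exists u, y v u != 0]]%SET.
have yirr v : y v v = 0.
  by apply/eqP; apply: contraT => /ye; rewrite eirr.
have posneg v : (#|pos v| + #|neg v| = #|supp v|)%N.
  rewrite -cardsUI (_ : pos v :&: neg v = finset.set0)%SET ?cards0 ?addn0.
    by apply: eq_card => u; rewrite !inE neq_lt orbC.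
  by apply/setP => u; rewrite !inE; case: ltrgt0P.
have sub v : supp v \subset [set u | e v u]%SET.
  by apply/fintype.subsetP => u; rewrite !inE; apply: ye.
have le2 v : (#|pos v| + #|neg v| <= 2)%N.
  by rewrite posneg; apply: leq_trans (subset_leq_card (sub v)) (deg2 v).
have one v : v != v0 -> (#|pos v| = (v \in K))%N /\ (#|neg v| = (v \in K))%N.
  move=> vv0; rewrite inE; case: existsP => [[u yvu]|vK].
    have [[j yj] [k yk]] := sumr_eq0_signs (row0 _ vv0) yvu.
    have : (0 < #|pos v|)%N by apply/card_gt0P; exists j; rewrite inE.
    have : (0 < #|neg v|)%N by apply/card_gt0P; exists k; rewrite inE.
    by move: (le2 v) => ? ? ?; split=> /=; lia.
  have : (#|pos v| + #|neg v| = 0)%N.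
    rewrite posneg; apply/eqP; rewrite cards_eq0; apply/eqP/setP => u.
    by rewrite !inE; apply/negbTE/negP => yvu; apply: vK; exists u.
  by move=> ?; split=> /=; lia.
have v0K : v0 \in K.
  rewrite inE; apply: contraT; rewrite negb_exists => /forallP v0K.
  by rewrite big1 ?eqxx // in rowv0 => u _; apply/eqP/negPn.
(* Each vertex of [K] other than [v0] has [h]-degree 1, so the degree sum, even by [handshake], is
   [#|h v0| + #|K|.-1]. This is used for the positive and for the negative edges. *)
have parity (h : V -> {set V}) : (forall v, v != v0 -> #|h v| = (v \in K) :> nat) ->
    (forall u v, (u \in h v) = (v \in h u)) -> (forall v, v \notin h v) ->
    ~~ odd (#|h v0| + #|K|.-1).
  move=> hK hsym hirr.
  have <- : (\sum_v #|h v| = #|h v0| + #|K|.-1)%N.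
    rewrite (bigD1 v0) //=; congr addn; rewrite [in RHS](cardsD1 v0) v0K /=.
    rewrite -sum1_card [RHS]big_mkcond [LHS]big_mkcond; apply: eq_bigr => v _ /=.
    by rewrite in_setD1; case: eqVneq => //= /hK ->; case: (_ \in K).
  have -> : (\sum_v #|h v| = \sum_v #|[set u | u \in h v]%SET|)%N.
    by apply: eq_bigr => v _; apply: eq_card => u; rewrite inE.
  rewrite (@handshake _ (fun v u => u \in h v)) ?oddM //.
  by move=> v; apply/negbTE.
have ppar : ~~ odd (#|pos v0| + #|K|.-1).
  by apply: parity => [v /one[]|u v|v]; rewrite ?inE 1?ysym ?yirr ?ltxx.
have npar : ~~ odd (#|neg v0| + #|K|.-1).
  by apply: parity => [v /one[]|u v|v]; rewrite ?inE 1?ysym ?yirr ?ltxx.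
have pn0 : (0 < #|pos v0| + #|neg v0|)%N.
  rewrite posneg; apply/card_gt0P; move: v0K; rewrite inE => /existsP[u yu].
  by exists u; rewrite inE.
have K0 : (0 < #|K|)%N by apply/card_gt0P; exists v0.
have [pq|pq] := eqVneq #|pos v0| #|neg v0|.
  left; exists (fun u v => Num.sg (y u v)).
    split=> [u v|u v|]; rewrite ?sgr_eq0; [by rewrite ysym | exact: ye |].
    by exists a, b; rewrite sgr_eq0.
  move=> u; rewrite sum_sgr; have [->|uv0] := eqVneq u v0.
    by rewrite -/(pos v0) -/(neg v0) pq subrr.
  by rewrite -/(pos u) -/(neg u) !(one u uv0).1 !(one u uv0).2 subrr.
(* The two counts at [v0] have equal parity, differ, and add up to 1 or 2, so they are 2 and 0;
   hence [#|K|] is odd. *)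
right; exists K; split.
- by move: (le2 v0); lia.
- move=> u v uK euv.
  (* Two support edges at [u] exhaust the at most two edges of [e] there, so every edge of [e]
     leaving [u] lies in the support. *)
  have E2 : (#|supp u| = 2)%N.
    rewrite -posneg; have [->|uv0] := eqVneq u v0; first by move: (le2 v0); lia.
    by rewrite !(one u uv0).1 !(one u uv0).2 uK.
  have : v \in supp u.
    have /eqP -> : supp u == [set w | e u w]%SET.
      by rewrite eqEcard sub E2 deg2.
    by rewrite inE.
  by rewrite !inE ysym => yvu; apply/existsP; exists u.
- by move=> u; rewrite inE => /existsP[v /ye]; exists v.
Qed.

(** Every non-isolated vertex has degree at least 2, so the set [B] of these vertices is at most as
    large as the edge set. If it is smaller, the row equations on [B] are underdetermined. If the
    sizes agree, all degrees on [B] are 2, and the two-regular case applies. *)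
Lemma balanced_weight_or_odd_closed (F : realFieldType) (V : finType) (e : rel V) :
  symmetric e -> irreflexive e ->
  (forall u v, e u v -> exists2 w, w != v & e u w) -> (exists u v, e u v) ->
  (exists2 y : V -> V -> F, edge_weight e y & forall u, \sum_v y u v = 0) \/
  (exists K : {set V}, [/\ odd #|K|, forall u v, u \in K -> e u v -> v \in K
     & forall u, u \in K -> exists v, e u v]).
Proof.
move=> esym eirr deg [v0 [v1 e01]].
pose B := [set v | [exists u, e v u]]%SET.
pose deg_ v := #|[set u | e v u]%SET|.
have degB v : (2 * (v \in B) <= deg_ v)%N.
  rewrite inE; case: existsP => [[u evu]|]; last by lia.
  have [w wu evw] := deg v u evu; rewrite muln1.
  have <- : #|[set u; w]%SET| = 2%N by rewrite cards2 eq_sym wu.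
  by apply: subset_leq_card; apply/fintype.subsetP => z; rewrite !inE => /orP[]/eqP->.
have sumB : (\sum_v 2 * (v \in B) = 2 * #|B|)%N.
  rewrite -sum1_card big_distrr /= [RHS]big_mkcond.
  by apply: eq_bigr => v _; case: (v \in B).
have hs : (\sum_v deg_ v = 2 * #|edge_set e|)%N := handshake esym eirr.
have leBE : (#|B| <= #|edge_set e|)%N.
  by rewrite -(leq_pmul2l (ltn0Sn 1)) -sumB -hs; apply: leq_sum => v _; apply: degB.
have v0B : v0 \in B by rewrite inE; apply/existsP; exists v1.
(* The unknowns are the unordered edges: [z] lives on [edge_set e]. *)
have sol (P : {set V}) : (#|P| < #|edge_set e|)%N ->
    exists2 y : V -> V -> F, edge_weight e y & forall u, u \in P -> \sum_v y u v = 0.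
  move=> ltP.
  have [z [[Q zQ] z0 zP]] := underdetermined_kernel
    (fun u Q => \sum_v (if e u v && (Q == [set u; v]%SET) then 1 else 0 : F)) ltP.
  exists (fun u v => if e u v then z [set u; v]%SET else 0).
    split=> [u v|u v|]; first by rewrite esym finset.setUC.
      by case: ifP => //; rewrite eqxx.
    have /edge_setP[u [v [euv EQ]]] : Q \in edge_set e.
      by apply: contraT => /z0; move/eqP: zQ.
    by exists u, v; rewrite euv -EQ.
  move=> u uP; rewrite -[RHS](zP u uP); under [RHS]eq_bigr do rewrite mulr_suml.
  rewrite [RHS]exchange_big; apply: eq_bigr => v _ /=.
  rewrite (bigD1 [set u; v]%SET) //= eqxx andbT big1 ?addr0.
    by case: ifP; rewrite ?mul1r ?mul0r.
  by move=> R /negbTE ->; rewrite andbF mul0r.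
have [EB|ltBE] := eqVneq #|B| #|edge_set e|; last first.
  have [|y cy yB] := sol B; first by lia.
  left; exists y => // u; have [/yB//|uB] := boolP (u \in B).
  case: cy => _ ye _; rewrite big1 // => v _; apply/eqP; apply: contraNT uB => /ye euv.
  by rewrite inE; apply/existsP; exists v.
(* Dropping the equation at one vertex leaves one unknown too many. *)
have [|y cy yB] := sol (B :\ v0)%SET.
  by rewrite -EB [in X in (_ < X)%N](cardsD1 v0) v0B.
apply: (@balanced_weight_two_regular F V e y v0) => //.
  (* Equality in the degree sum forces equality at each vertex. *)
  move=> v; have : (\sum_v (deg_ v - 2 * (v \in B)) = 0)%N.
    by rewrite sumnB ?hs ?sumB ?EB ?subnn // => i _; apply: degB.
  move/eqP; rewrite sum_nat_eq0 => /forallP/(_ v); rewrite /= subn_eq0 => /leq_trans-> //.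
  by case: (v \in B).
move=> v vv0; have [vB|vB] := boolP (v \in B); first by apply: yB; rewrite in_setD1 vv0.
case: cy => _ ye _; rewrite big1 // => u _; apply/eqP; apply: contraNT vB => /ye euv.
by rewrite inE; apply/existsP; exists u.
Qed.

(** * The perfect matching polytope *)

Definition cut (F : realFieldType) (V : finType) (x : V -> V -> F) (S : {set V}) : F :=
  \sum_(u in S) \sum_(v in ~: S) x u v.

(* [A] is the vertex set of a graph inside the ambient type [V]; [x] vanishes
   outside [A], by the last clause. *)
Definition fractional_matching (F : realFieldType) (V : finType) (A : {set V})
    (x : V -> V -> F) :=
  [/\ forall u v, 0 <= x u v, forall u v, x u v = x v u, forall u, x u u = 0
    & forall u, \sum_v x u v = (u \in A)%:R].

Definition matching_polytope (F : realFieldType) (V : finType) (A : {set V})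
    (x : V -> V -> F) :=
  fractional_matching A x /\
  forall S : {set V}, S \subset A -> odd #|S| -> 1 <= cut x S.

(* A perfect matching of [A] inside the support of [x] is encoded as the
   involution exchanging the ends of each edge. *)
Definition matching (F : realFieldType) (V : finType) (A : {set V})
    (x : V -> V -> F) (f : V -> V) : bool :=
  [forall v in A, [&& f v \in A, f (f v) == v & 0 < x v (f v)]].

(** Membership of [x] in the convex hull of the matchings in its support, tested by linear
    functionals. Both sides count an edge in both orientations, so [w] need not be symmetric. *)
Definition dominated (F : realFieldType) (V : finType) (A : {set V})
    (x : V -> V -> F) :=
  forall w : V -> V -> F, exists2 f : V -> V, matching A x f &
    \sum_u \sum_v w u v * x u v <= \sum_(v in A) w v (f v).

Lemma matchingP (F : realFieldType) (V : finType) (A : {set V})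
    (x : V -> V -> F) (f : V -> V) :
  reflect (forall v, v \in A -> [/\ f v \in A, f (f v) = v & 0 < x v (f v)])
    (matching A x f).
Proof.
apply: (iffP forallP) => H v; last first.
  by apply/implyP => /H[-> -> ->]; rewrite eqxx.
by move=> vA; move/(_ v): H; rewrite vA => /and3P[-> /eqP -> ->].
Qed.

Lemma fractional_supp (F : realFieldType) (V : finType) (A : {set V})
    (x : V -> V -> F) u v : fractional_matching A x -> u \notin A -> x u v = 0.
Proof.
move=> [x0 _ _ rows] /negbTE uA; have := rows u; rewrite uA.
by move/psumr_eq0P => /(_ (fun i _ => x0 u i)) /(_ v isT).
Qed.

Lemma sum_setC (F : realFieldType) (V : finType) (S : {set V}) (g : V -> F) :
  \sum_v g v = \sum_(v in S) g v + \sum_(v in ~: S) g v.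
Proof.
by rewrite (bigID (mem S)) /=; congr (_ + _); apply: eq_bigl => v; rewrite !inE.
Qed.

(** Each row over [S] sums to 1. The cut thus depends only on the entries inside [S], which
    contraction preserves. *)
Lemma cut_inner (F : realFieldType) (V : finType) (A S : {set V})
    (x : V -> V -> F) : fractional_matching A x -> S \subset A ->
  cut x S = #|S|%:R - \sum_(u in S) \sum_(v in S) x u v.
Proof.
move=> [_ _ _ rows] /fintype.subsetP SA.
rewrite -sum1_card natr_sum -sumrB; apply: eq_bigr => u uS.
by have := rows u; rewrite (SA u uS) (sum_setC S) => <-; rewrite addrAC subrr add0r.
Qed.

Lemma cutC (F : realFieldType) (V : finType) (A S : {set V})
    (x : V -> V -> F) : fractional_matching A x -> S \subset A ->
  cut x (A :\: S)%SET = cut x S.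
Proof.
move=> fx SA; have [x0 xsym _ rows] := fx.
rewrite /cut [RHS]exchange_big /= [RHS](bigID (mem A)) /= [X in _ = _ + X]big1 ?addr0.
  apply: eq_big => [u|u _]; first by rewrite !inE.
  rewrite [LHS](bigID (mem A)) /= [X in _ + X]big1 ?addr0; last first.
    by move=> v /andP[_ vA]; rewrite xsym (fractional_supp _ fx).
  apply: eq_big => [v|v _]; last exact: xsym.
  rewrite !inE; have [/(fintype.subsetP SA) ->//|] := boolP (v \in S).
  by case: (v \in A).
by move=> v /andP[_ vA]; rewrite big1 // => u _; rewrite xsym (fractional_supp _ fx).
Qed.

Lemma cut_trivial (F : realFieldType) (V : finType) (A S : {set V})
    (x : V -> V -> F) : fractional_matching A x -> S \subset A -> #|S| = 1%N ->
  cut x S = 1.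
Proof.
move=> fx SA S1; rewrite (cut_inner fx SA) S1.
have /cards1P[u ->] : #|S| == 1%N by rewrite S1.
by have [_ _ xx _] := fx; rewrite !big_set1 xx subr0.
Qed.

(** The cut of [A] is that of the empty set, namely 0, which violates the odd cut condition if
    [#|A|] is odd. *)
Lemma matching_polytope_even (F : realFieldType) (V : finType) (A : {set V})
    (x : V -> V -> F) : matching_polytope A x -> ~~ odd #|A|.
Proof.
move=> [fx odds]; apply/negP => oddA; have := odds A (fintype.subxx A) oddA.
rewrite -(cutC fx) // finset.setDv /cut big_set0; lra.
Qed.

Lemma odd_setD (V : finType) (A S : {set V}) : ~~ odd #|A| -> S \subset A ->
  odd #|A :\: S|%SET = odd #|S|.
Proof.
move=> eA SA; have := cardsID S A; rewrite (finset.setIidPr SA); move: eA => /[swap] <-.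
by rewrite oddD; case: (odd _); case: (odd _).
Qed.

(* Singletons and their complements have cut 1 automatically. *)
Lemma matching_polytope_nontrivial (F : realFieldType) (V : finType) (A : {set V})
    (x : V -> V -> F) : ~~ odd #|A| -> fractional_matching A x ->
  (forall S : {set V}, S \subset A -> odd #|S| -> (1 < #|S|)%N ->
    (1 < #|A :\: S|%SET)%N -> 1 <= cut x S) ->
  matching_polytope A x.
Proof.
move=> eA fx H; split=> // S SA oS.
have [S1|S1] := ltnP 1 #|S|; last by rewrite (cut_trivial fx SA) //; case: #|S| S1 oS => [|[]].
have [D1|D1] := ltnP 1 #|A :\: S|%SET; first exact: H.
rewrite -(cutC fx SA) (cut_trivial fx) ?finset.subsetDl //.
by have := odd_setD eA SA; rewrite oS; case: #|_| D1 => [|[]].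
Qed.

(** * Contraction and gluing along a tight odd cut *)

(* Contracts the complement of [S] to the single vertex [t]. *)
Definition contract (F : realFieldType) (V : finType) (S : {set V}) (t : V)
    (x : V -> V -> F) (u v : V) : F :=
  if u \in S then
    if v \in S then x u v else if v == t then \sum_(z in ~: S) x u z else 0
  else if (u == t) && (v \in S) then \sum_(z in ~: S) x v z else 0.

(** Tightness is what makes the row of [t] sum to 1; the rows over [S] keep their sums. *)
Lemma contract_fractional (F : realFieldType) (V : finType) (A S : {set V}) (t : V)
    (x : V -> V -> F) : fractional_matching A x -> S \subset A ->
  t \notin S -> cut x S = 1 -> fractional_matching (t |: S)%SET (contract S t x).
Proof.
move=> [x0 xsym xx rows] /fintype.subsetP SA tS cS; split.
- move=> u v; rewrite /contract; case: ifP => _; case: ifP => _ //; last by apply: sumr_ge0.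
  by case: ifP => _ //; apply: sumr_ge0.
- move=> u v; rewrite /contract.
  by case: (boolP (u \in S)); case: (boolP (v \in S)); rewrite /= ?andbT ?andbF.
- move=> u; rewrite /contract; by case: (boolP (u \in S)); rewrite ?andbF.
move=> u; rewrite !inE (sum_setC S) /contract.
have [uS|uS] := boolP (u \in S).
  rewrite orbT; have := rows u; rewrite (SA u uS) /= => <-.
  rewrite [RHS](sum_setC S); congr (_ + _).
    by apply: eq_bigr => v ->.
  rewrite (bigD1 t) /=; last by rewrite inE.
  rewrite (negbTE tS) eqxx [X in _ + X]big1 ?addr0 // => v.
  by rewrite inE => /andP[/negbTE -> /negbTE ->].
rewrite orbF [X in _ + X]big1 ?addr0; last first.
  by move=> v; rewrite inE => /negbTE ->; rewrite andbF.
case: eqP => _; last by rewrite big1.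
by rewrite -[RHS]cS; apply: eq_bigr => v vS; rewrite vS.
Qed.

(** An odd set inside [S] has the same cut as before; one containing [t] is replaced by its
    complement, which is odd and avoids [t]. *)
Lemma contract_polytope (F : realFieldType) (V : finType) (A S : {set V}) (t : V)
    (x : V -> V -> F) : matching_polytope A x -> S \subset A -> odd #|S| ->
  t \notin S -> cut x S = 1 -> matching_polytope (t |: S)%SET (contract S t x).
Proof.
move=> [fx odds] SA oS tS cS; have fc := contract_fractional fx SA tS cS.
have inS (T : {set V}) : T \subset S -> odd #|T| -> 1 <= cut (contract S t x) T.
  move=> TS oT; have TA := fintype.subset_trans TS SA.
  rewrite (cut_inner fc); last exact: fintype.subset_trans TS (finset.subsetUr _ _).
  have := odds T TA oT; rewrite (cut_inner fx TA) => /le_trans; apply.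
  rewrite lerD2l lerN2; apply: ler_sum => u uT; apply: ler_sum => v vT.
  by rewrite /contract (fintype.subsetP TS _ uT) (fintype.subsetP TS _ vT).
split=> // T TtS oT; have [tT|tT] := boolP (t \in T); last first.
  apply: inS => //; apply/fintype.subsetP => v vT.
  have := fintype.subsetP TtS v vT; rewrite !inE => /orP[/eqP E|//].
  by rewrite -E vT in tT.
rewrite -(cutC fc TtS); apply: inS.
  by apply/fintype.subsetP => v; rewrite !inE; case: eqP => [->|_ /andP[]//]; rewrite tT.
by rewrite odd_setD // cardsU1 tS /= oS.
Qed.

Lemma finite_max (F : realFieldType) (I : finType) (P : pred I) (g : I -> F) :
  (exists i, P i) -> exists2 i, P i & forall j, P j -> g j <= g i.
Proof.
move=> [i0 Pi0]; have [i Pi H] := @arg_maxP _ _ _ i0 P g Pi0.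
by exists i.
Qed.

Lemma finite_matching (F : realFieldType) (V : finType) (A : {set V})
    (x : V -> V -> F) (f : V -> V) : matching A x [ffun v => f v] = matching A x f.
Proof. by apply: eq_forallb => v; rewrite !ffunE. Qed.

Lemma max_matching (F : realFieldType) (V : finType) (A : {set V})
    (x w : V -> V -> F) : (exists f, matching A x f) ->
  exists2 f, matching A x f & forall g, matching A x g ->
    \sum_(v in A) w v (g v) <= \sum_(v in A) w v (f v).
Proof.
move=> [f0 mf0].
have [|f mf fmax] := @finite_max F {ffun V -> V} (fun f => matching A x f)
  (fun f => \sum_(v in A) w v (f v)).
  by exists [ffun v => f0 v]; rewrite finite_matching.
exists f => // g mg; have := fmax [ffun v => g v]; rewrite finite_matching => /(_ mg).
by under eq_bigr do rewrite ffunE.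
Qed.

(** Deleting the edge at [t] from a matching of the contracted graph leaves a matching of [S]
    without the partner of [t]. *)
Lemma contract_matchingD1 (F : realFieldType) (V : finType) (S : {set V}) (t u : V)
    (x : V -> V -> F) (f : V -> V) : t \notin S -> u \in S ->
  matching (t |: S)%SET (contract S t x) f -> f t = u -> matching (S :\ u)%SET x f.
Proof.
move=> tS uS /matchingP mf ftu; apply/matchingP => v; rewrite !inE => /andP[vu vS].
have tt : t \in (t |: S)%SET by rewrite !inE eqxx.
have vv : v \in (t |: S)%SET by rewrite !inE vS orbT.
have [_ fft _] := mf t tt; have [fv ffv xv] := mf v vv.
have fvt : f v != t by apply: contraNneq vu => E; rewrite -ffv E ftu.
have fvS : f v \in S by move: fv; rewrite !inE (negbTE fvt).
split=> //; last by move: xv; rewrite /contract vS fvS.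
rewrite fvS andbT; apply: contraNneq tS => E; rewrite -fft ftu -E ffv //.
Qed.

(* Giving the edges at [t] the weights [- alpha u] makes every matching of the
   contracted graph have weight at most 0. *)
Lemma contract_dual (F : realFieldType) (V : finType) (A S : {set V}) (t : V)
    (x : V -> V -> F) : fractional_matching A x -> t \notin S ->
  dominated (t |: S)%SET (contract S t x) ->
  forall w : V -> V -> F, exists2 alpha : V -> F,
    (forall u, u \in S -> 0 < \sum_(z in ~: S) x u z ->
       exists2 f, matching (S :\ u)%SET x f & alpha u = \sum_(v in S :\ u) w v (f v)) &
    \sum_(u in S) \sum_(v in S) w u v * x u v <=
      \sum_(u in S) alpha u * \sum_(z in ~: S) x u z.
Proof.
move=> [x0 xsym xx rows] tS dom w.
set out := fun u => \sum_(z in ~: S) x u z.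
have tt : t \in (t |: S)%SET by rewrite !inE eqxx.
have ex u : u \in S -> 0 < out u -> exists f, matching (S :\ u)%SET x f.
  (* The indicator of the edge from [u] to [t] has positive value on the contracted weight, so some
     matching uses that edge. *)
  move=> uS out0; pose w0 a b : F := ((a == u) && (b == t))%:R.
  have [f mf] := dom w0.
  have -> : \sum_a \sum_b w0 a b * contract S t x a b = out u.
    rewrite (bigD1 u) //= (bigD1 t) //= /w0 !eqxx mul1r /contract uS (negbTE tS) eqxx.
    rewrite [X in _ + X + _]big1 ?[X in _ + _ + X]big1 ?addr0 //.
      by move=> a /negbTE ->; rewrite big1 // => b _; rewrite mul0r.
    by move=> b /negbTE ->; rewrite andbF mul0r.
  move=> le; exists f; apply: (contract_matchingD1 tS uS mf).
  have uu : u \in (t |: S)%SET by rewrite !inE uS orbT.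
  move/matchingP: (mf) => /(_ u uu)[_ ffu _]; rewrite -[RHS]ffu; congr f.
  apply/esym/eqP; apply: contraTT le => fut; rewrite -ltNge big1 // => v _.
  by rewrite /w0; case: eqP => //= ->; rewrite (negbTE fut).
(* [alpha u] is the largest weight of a matching of [S :\ u]. *)
have /choice[alpha alphaP] : forall u, exists a : F, u \in S -> 0 < out u ->
    (exists2 f, matching (S :\ u)%SET x f & a = \sum_(v in S :\ u) w v (f v)) /\
    forall g, matching (S :\ u)%SET x g -> \sum_(v in S :\ u) w v (g v) <= a.
  move=> u; have [uS|uS] := boolP (u \in S); last by exists 0.
  have [out0|out0] := boolP (0 < out u); last by exists 0.
  have [f mf fmax] := max_matching w (ex u uS out0).
  by exists (\sum_(v in S :\ u) w v (f v)) => _ _; split=> //; exists f.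
exists alpha; first by move=> u uS out0; have [] := alphaP u uS out0.
pose w1 a b := if a \in S then if b \in S then w a b else - alpha a else 0.
have [f mf] := dom w1.
move/matchingP: (mf) => /(_ t tt)[ftS fft xt].
have uS : f t \in S.
  apply: contraTT xt => /negbTE ftn; rewrite /contract (negbTE tS) ftn andbF.
  by rewrite ltxx.
have out0 : 0 < out (f t) by move: xt; rewrite /contract (negbTE tS) eqxx uS.
have mD : matching (S :\ f t)%SET x f by apply: (contract_matchingD1 tS uS mf).
have [_ /(_ f mD) amax] := alphaP _ uS out0.
have -> : \sum_u \sum_v w1 u v * contract S t x u v =
    \sum_(u in S) \sum_(v in S) w u v * x u v - \sum_(u in S) alpha u * out u.
  rewrite (sum_setC S) [X in _ + X]big1 ?addr0; last first.
    by move=> u; rewrite inE => /negbTE uN; rewrite big1 // => v _; rewrite /w1 uN mul0r.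
  rewrite -sumrB; apply: eq_bigr => u uinS; rewrite (sum_setC S); congr (_ + _).
    by apply: eq_bigr => v vS; rewrite /w1 /contract uinS vS.
  rewrite (bigD1 t) /=; last by rewrite inE.
  rewrite /w1 /contract uinS (negbTE tS) eqxx mulNr [X in _ + X]big1 ?addr0 // => v.
  by rewrite inE => /andP[/negbTE -> /negbTE ->]; rewrite mulr0.
have -> : \sum_(v in t |: S) w1 v (f v) =
    - alpha (f t) + \sum_(v in S :\ f t) w v (f v).
  rewrite big_setU1 //= {1}/w1 (negbTE tS) add0r (big_setD1 (f t)) //=; congr (_ + _).
    by rewrite /w1 uS fft (negbTE tS).
  apply: eq_bigr => v vD; have [fvD _ _] := matchingP _ _ _ mD v vD.
  by move: vD fvD; rewrite !inE /w1 => /andP[_ ->] /andP[_ ->].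
by lra.
Qed.

(** Otherwise all terms [(T - c i) * p i] are nonnegative with sum at most 0, so they vanish and
    every [p i] is 0, contrary to their sum 1. *)
Lemma averaging (F : realFieldType) (I : finType) (P : pred I) (p c : I -> F) (T : F) :
  (forall i, P i -> 0 <= p i) -> \sum_(i | P i) p i = 1 ->
  T <= \sum_(i | P i) c i * p i -> exists i, [/\ P i, 0 < p i & T <= c i].
Proof.
move=> p0 p1 Tle; apply: contrapT => no.
have ge0 i : P i -> 0 <= (T - c i) * p i.
  move=> Pi; have [pi|pi] := ltP 0 (p i); last first.
    by rewrite (_ : p i = 0) ?mulr0 //; apply/le_anti; rewrite pi p0.
  apply: mulr_ge0; rewrite ?p0 // subr_ge0 leNgt; apply/negP => /ltW lt; apply: no.
  by exists i.
have s0 : \sum_(i | P i) (T - c i) * p i = 0.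
  apply/le_anti; rewrite sumr_ge0 // andbT.
  under eq_bigr do rewrite mulrBl.
  by rewrite sumrB -mulr_sumr p1 mulr1 subr_le0.
have : \sum_(i | P i) p i = 0.
  apply: big1 => i Pi; have /eqP := psumr_eq0P ge0 s0 Pi.
  rewrite mulf_eq0 subr_eq0 => /orP[/eqP Tc|/eqP//].
  apply: contrapT => /eqP pi; apply: no; exists i; split=> //; last by rewrite Tc.
  by rewrite lt_def pi p0.
by rewrite p1 => /eqP; rewrite oner_eq0.
Qed.

Lemma sum_subset (F : realFieldType) (V : finType) (A S : {set V}) (h : V -> F) :
  S \subset A ->
  \sum_(v in A) h v = \sum_(v in S) h v + \sum_(v in A :\: S) h v.
Proof.
by move=> SA; rewrite (finset.big_setID S) /= (finset.setIidPr SA).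
Qed.

(** [alpha] and [beta] bound the weight inside the two sides by sums over the cut edges, whose
    [x]-values add up to 1. By averaging, some cut edge [uv] has [alpha u + beta v + w u v + w v u]
    at least the objective; the matchings realising [alpha u] and [beta v] are joined by [uv]. *)
Lemma tight_cut_dominated (F : realFieldType) (V : finType) (A S : {set V}) (s t : V)
    (x : V -> V -> F) : fractional_matching A x -> S \subset A -> cut x S = 1 ->
  s \in S -> t \in (A :\: S)%SET -> dominated (t |: S)%SET (contract S t x) ->
  dominated (s |: (A :\: S))%SET (contract (A :\: S)%SET s x) -> dominated A x.
Proof.
move=> fx SA cS sS tD dom1 dom2 w; have [x0 xsym xx rows] := fx.
set D := (A :\: S)%SET in tD dom2 *.
have tS : t \notin S by move: tD; rewrite !inE => /andP[].
have sD : s \notin D by rewrite !inE sS.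
have [alpha alphaP alphaS] := contract_dual fx tS dom1 w.
have [beta betaP betaD] := contract_dual fx sD dom2 w.
have xA u v : v \notin A -> x u v = 0 by rewrite xsym; apply: fractional_supp.
have sumA (h : V -> F) : (forall v, v \notin A -> h v = 0) ->
    \sum_v h v = \sum_(v in S) h v + \sum_(v in D) h v.
  move=> h0; rewrite (sum_setC A) [X in _ + X]big1 ?addr0; first exact: sum_subset.
  by move=> v; rewrite inE; apply: h0.
have outS u : \sum_(z in ~: S) x u z = \sum_(z in D) x u z.
  have := sumA (x u) (xA u); rewrite (sum_setC S) => /addrI //.
have outD u : \sum_(z in ~: D) x u z = \sum_(z in S) x u z.
  have := sumA (x u) (xA u); rewrite (sum_setC D) addrC => /addIr //.
have cross : \sum_u \sum_v w u v * x u v <=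
    \sum_(u in S) \sum_(v in D) (alpha u + beta v + w u v + w v u) * x u v.
  rewrite sumA; last first.
    by move=> v vA; rewrite big1 // => u _; rewrite xsym xA ?mulr0.
  have -> : \sum_(u in S) \sum_v w u v * x u v = \sum_(u in S) \sum_(v in S) w u v * x u v
      + \sum_(u in S) \sum_(v in D) w u v * x u v.
    rewrite -big_split; apply: eq_bigr => u _ /=.
    by rewrite sumA // => v vA; rewrite xA ?mulr0.
  have -> : \sum_(u in D) \sum_v w u v * x u v = \sum_(u in S) \sum_(v in D) w v u * x u v
      + \sum_(u in D) \sum_(v in D) w u v * x u v.
    rewrite [X in X + _]exchange_big -big_split; apply: eq_bigr => u _ /=.
    rewrite sumA; last by move=> v vA; rewrite xA ?mulr0.
    by congr (_ + _); apply: eq_bigr => v _; rewrite xsym.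
  have -> : \sum_(u in S) \sum_(v in D) (alpha u + beta v + w u v + w v u) * x u v =
      \sum_(u in S) alpha u * (\sum_(z in ~: S) x u z)
      + \sum_(u in D) beta u * (\sum_(z in ~: D) x u z)
      + \sum_(u in S) \sum_(v in D) w u v * x u v
      + \sum_(u in S) \sum_(v in D) w v u * x u v.
    have -> : \sum_(u in D) beta u * (\sum_(z in ~: D) x u z) =
        \sum_(u in S) \sum_(v in D) beta v * x u v.
      rewrite [RHS]exchange_big; apply: eq_bigr => u _; rewrite outD mulr_sumr.
      by apply: eq_bigr => v _; rewrite xsym.
    rewrite -!big_split; apply: eq_bigr => u _ /=.
    rewrite outS mulr_sumr -!big_split; apply: eq_bigr => v _ /=; ring.
  by lra.
have [[u v] [/= /andP[uS vD] xuv ge]] : exists p : V * V,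
    [/\ (p.1 \in S) && (p.2 \in D), 0 < x p.1 p.2 &
     \sum_u \sum_v w u v * x u v <= alpha p.1 + beta p.2 + w p.1 p.2 + w p.2 p.1].
  apply: (@averaging F (V * V)%type (fun p => (p.1 \in S) && (p.2 \in D))
    (fun p => x p.1 p.2)
    (fun p => alpha p.1 + beta p.2 + w p.1 p.2 + w p.2 p.1)) => //.
    rewrite -(pair_big (mem S) (mem D) x) /= -[RHS]cS.
    by apply: eq_bigr => u _; rewrite outS.
  by rewrite -(pair_big (mem S) (mem D)
    (fun u v => (alpha u + beta v + w u v + w v u) * x u v)).
have [f mf alphaE] : exists2 f, matching (S :\ u)%SET x f &
    alpha u = \sum_(v in S :\ u) w v (f v).
  apply: alphaP => //; rewrite outS (bigD1 v) //=.
  by apply: ltr_wpDr => //; apply: sumr_ge0.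
have [g mg betaE] : exists2 g, matching (D :\ v)%SET x g &
    beta v = \sum_(z in D :\ v) w z (g z).
  apply: betaP => //; rewrite outD (bigD1 u) //= xsym.
  by apply: ltr_wpDr => //; apply: sumr_ge0.
(* The glued matching: [uv] is swapped, [f] acts on the rest of [S] and [g] on the rest of [D]. *)
pose h z := if z == u then v else if z == v then u else if z \in S then f z else g z.
have uD : u \notin D by rewrite !inE uS.
have vS : v \notin S by move: vD; rewrite !inE => /andP[].
have vu : v == u = false by apply: contraNF vS => /eqP ->.
have hf z : z \in (S :\ u)%SET -> h z = f z.
  rewrite /h !inE => /andP[/negbTE -> zS]; rewrite zS.
  by case: eqP zS => // ->; rewrite (negbTE vS).
have hg z : z \in (D :\ v)%SET -> h z = g z.
  rewrite /h in_setD1 => /andP[/negbTE -> zD].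
  have -> : z \in S = false by apply: contraTF zD => zS; rewrite !inE zS.
  by case: eqP zD => // ->; rewrite (negbTE uD).
have hu : h u = v by rewrite /h eqxx.
have hv : h v = u by rewrite /h vu eqxx.
have DA z : z \in D -> z \in A by rewrite !inE => /andP[].
exists h.
  apply/matchingP => z zA; have [->|zu] := eqVneq z u.
    by rewrite hu hv DA.
  have [->|zv] := eqVneq z v; first by rewrite hv hu xsym (fintype.subsetP SA).
  have [zS|zS] := boolP (z \in S).
    have zSu : z \in (S :\ u)%SET by rewrite !inE zu.
    have [fz ffz xz] := matchingP _ _ _ mf z zSu; rewrite hf // hf //; split=> //.
    by move: fz; rewrite !inE => /andP[_ /(fintype.subsetP SA)].
  have zDv : z \in (D :\ v)%SET by rewrite !inE zv zS.
  have [gz ggz xz] := matchingP _ _ _ mg z zDv; rewrite hg // hg //; split=> //.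
  by move: gz; rewrite in_setD1 => /andP[_ /DA].
have sumh_S : \sum_(z in S) w z (h z) = w u v + alpha u.
  rewrite (big_setD1 u) //= hu alphaE; congr (_ + _).
  by apply: eq_bigr => z zS; rewrite hf.
have sumh_D : \sum_(z in D) w z (h z) = w v u + beta v.
  rewrite (big_setD1 v) //= hv betaE; congr (_ + _).
  by apply: eq_bigr => z zD; rewrite hg.
apply: le_trans ge _; rewrite (sum_subset _ SA) -/D sumh_S sumh_D; lra.
Qed.

(** * Moving within the polytope, and Edmonds' theorem *)

(** The ratio test: [t] is the least [s i / - d i] over the constraints that decrease along [d]. *)
Lemma first_blocking (F : realFieldType) (I : finType) (P : pred I) (s d : I -> F) :
  (forall i, P i -> 0 < s i) -> (exists2 i, P i & d i < 0) ->
  exists t, [/\ 0 <= t, forall i, P i -> 0 <= s i + t * d i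
    & exists2 i, P i & s i + t * d i = 0].
Proof.
move=> s0 [i0 Pi0 di0].
have Q0 : P i0 && (d i0 < 0) by rewrite Pi0.
have [i /andP[Pi di] H] := @arg_minP _ _ _ i0 (fun i => P i && (d i < 0))
  (fun i => s i / - d i) Q0.
have t0 : 0 < s i / - d i by apply: divr_gt0; rewrite ?s0 ?oppr_gt0.
exists (s i / - d i); split; first exact: ltW.
  move=> j Pj; have [dj|dj] := ltP (d j) 0; last first.
    by apply: addr_ge0; [exact/ltW/s0 | apply: mulr_ge0 => //; apply: ltW].
  have := H j; rewrite Pj dj => /(_ isT).
  rewrite ler_pdivlMr ?oppr_gt0 // mulrN => ?; lra.
by exists i => //; field; rewrite lt_eqF.
Qed.

Definition nontrivial_odd (V : finType) (A S : {set V}) : bool :=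
  [&& S \subset A, odd #|S|, 1 < #|S| & 1 < #|A :\: S|%SET]%N.

Lemma balanced_weight_neg_entry (F : realFieldType) (V : finType) (e : rel V)
    (y : V -> V -> F) : edge_weight e y -> (forall u, \sum_v y u v = 0) ->
  exists u v, y u v < 0.
Proof.
move=> [_ _ [u [v yuv]]] rows; have [_ [z yz]] := sumr_eq0_signs (rows u) yuv.
by exists u, z.
Qed.

Lemma polytope_move (F : realFieldType) (V : finType) (A : {set V})
    (x y : V -> V -> F) : matching_polytope A x ->
  edge_weight (fun u v => 0 < x u v) y -> (forall u, \sum_v y u v = 0) ->
  (forall S, nontrivial_odd A S -> cut x S != 1) ->
  exists t, [/\ 0 <= t, matching_polytope A (fun u v => x u v + t * y u v) &
    (exists u v, 0 < x u v /\ x u v + t * y u v = 0) \/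
    (exists2 S, nontrivial_odd A S & cut (fun u v => x u v + t * y u v) S = 1)].
Proof.
move=> poly cy rowy notight; have eA := matching_polytope_even poly.
have [[x0 xsym xx rows] odds] := poly; have [ysym ysupp _] := cy.
have cutD t S : cut (fun u v => x u v + t * y u v) S = cut x S + t * cut y S.
  rewrite /cut mulr_sumr -big_split; apply: eq_bigr => u _ /=.
  by rewrite mulr_sumr -big_split.
(* The constraints are the positive entries and the nontrivial odd cuts, all with positive slack. At
   zero entries [y] vanishes, so these stay 0. *)
pose P (i : V * V + {set V}) :=
  match i with inl p => 0 < x p.1 p.2 | inr C => nontrivial_odd A C end.
pose s (i : V * V + {set V}) :=
  match i with inl p => x p.1 p.2 | inr C => cut x C - 1 end.
pose d (i : V * V + {set V}) :=
  match i with inl p => y p.1 p.2 | inr C => cut y C end.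
have [||t [t0 feas block]] := @first_blocking F (V * V + {set V})%type P s d.
- case=> [p|S] //= ntS; rewrite subr_gt0 lt_def notight //=.
  by case/and4P: ntS => ? ? _ _; apply: odds.
- have [u [v yuv]] := balanced_weight_neg_entry cy rowy.
  by exists (inl (u, v)) => //=; apply: ysupp; rewrite lt_eqF.
exists t; split=> //.
  apply: matching_polytope_nontrivial => //.
    split=> [u v|u v|u|u].
    - have [xuv|xuv] := boolP (0 < x u v); first exact: (feas (inl (u, v))).
      have -> : y u v = 0 by apply/eqP; apply: contraNT xuv; apply: ysupp.
      by rewrite mulr0 addr0.
    - by rewrite xsym ysym.
    - have -> : y u u = 0.
        by apply/eqP; apply: contraT => /ysupp; rewrite xx ltxx.
      by rewrite xx mulr0 addr0.
    - by rewrite big_split /= rows -mulr_sumr rowy mulr0 addr0.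
  move=> S SA oS S1 D1; rewrite cutD.
  have := feas (inr S); rewrite /= /nontrivial_odd SA oS S1 D1 => /(_ isT); lra.
case: block => -[[u v]|S] /= Pi E; first by left; exists u, v.
right; exists S => //; rewrite cutD; lra.
Qed.

(** A row over [A] with sum 1 and entries 0 or at least 1 contains a single 1. By symmetry the
    positions of these form a matching, whose weight equals the objective. *)
Lemma integral_dominated (F : realFieldType) (V : finType) (A : {set V})
    (x : V -> V -> F) : fractional_matching A x ->
  (forall u v, x u v = 0 \/ 1 <= x u v) -> dominated A x.
Proof.
move=> fx int w; have [x0 xsym xx rows] := fx.
have /choice[f fP] : forall v, exists u, v \in A -> x v u = 1 /\ forall z, z != u -> x v z = 0.
  move=> v; have [vA|vA] := boolP (v \in A); last by exists v.
  have row1 : \sum_u x v u = 1 by rewrite rows vA.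
  have [u xvu] : exists u, x v u <> 0.
    apply: contrapT => no; have : \sum_u x v u = 0.
      by apply: big1 => u _; apply: contrapT => xu; apply: no; exists u.
    by rewrite row1 => /eqP; rewrite oner_eq0.
  exists u => _; have [//|x1] := int v u.
  have rest : \sum_(z | z != u) x v z = 0.
    apply/le_anti; rewrite sumr_ge0 // andbT.
    move: row1; rewrite (bigD1 u) //=; lra.
  split; last by move=> z zu; apply: (psumr_eq0P _ rest).
  by move: row1; rewrite (bigD1 u) //= rest addr0.
exists f.
  apply/matchingP => v vA; have [xv _] := fP v vA.
  have fvA : f v \in A.
    apply: contraT => fvA; move: xv; rewrite xsym (fractional_supp _ fx fvA).
    by move/eqP; rewrite eq_sym oner_eq0.
  split=> //; last by rewrite xv.
  have [_ H] := fP _ fvA; apply/esym/eqP; apply: contraT => /H.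
  by rewrite xsym xv => /eqP; rewrite oner_eq0.
rewrite (sum_setC A) [X in _ + X]big1 ?addr0; last first.
  by move=> u; rewrite inE => uA; rewrite big1 // => v _;
    rewrite (fractional_supp _ fx uA) mulr0.
rewrite le_eqVlt; apply/orP; left; apply/eqP; apply: eq_bigr => v vA.
have [xv xz] := fP v vA; rewrite (bigD1 (f v)) //= xv mulr1 big1 ?addr0 //.
by move=> z zf; rewrite xz ?mulr0.
Qed.

Lemma fractional_row2 (F : realFieldType) (V : finType) (A : {set V})
    (x : V -> V -> F) u v z : fractional_matching A x -> z != v -> x u v + x u z <= 1.
Proof.
move=> [x0 _ _ rows] zv; have : \sum_a x u a <= 1 by rewrite rows; case: (u \in A).
rewrite (bigD1 v) //= (bigD1 z) //= addrA; apply: le_trans.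
by rewrite lerDl sumr_ge0.
Qed.

(** Row sums 1 prevent a vertex from having exactly one fractional edge. An odd closed set [K] would
    have cut 0: an edge leaving it is not fractional, and it cannot have value 1 because its end in
    [K] already carries a fractional edge. *)
Lemma polytope_balanced_weight (F : realFieldType) (V : finType) (A : {set V})
    (x : V -> V -> F) : matching_polytope A x -> (exists u v, 0 < x u v < 1) ->
  exists2 y : V -> V -> F, edge_weight (fun u v => 0 < x u v) y &
    forall u, \sum_v y u v = 0.
Proof.
move=> [fx odds] frac; have [x0 xsym xx rows] := fx.
pose e := [rel u v | 0 < x u v < 1].
have supp u v : 0 < x u v -> u \in A.
  by apply: contraTT => uA; rewrite (fractional_supp _ fx uA) ltxx.
have [|||||] := @balanced_weight_or_odd_closed F V e.
- by move=> u v; rewrite /= xsym.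
- by move=> u; rewrite /= xx ltxx.
- move=> u v /= /andP[xuv xuv1].
  have [z zv xuz] : exists2 z, z != v & 0 < x u z.
    apply: contrapT => no; have := rows u; rewrite (supp u v xuv) (bigD1 v) //= big1.
      by lra.
    move=> z zv; apply/le_anti; rewrite x0 andbT leNgt; apply/negP => xz.
    by apply: no; exists z.
  exists z => //; rewrite xuz /=; have := fractional_row2 u fx zv; lra.
- by [].
- move=> [y [ysym ye yn0] rowy]; exists y => //; split=> // u v /ye /=.
  by case/andP.
move=> [K [oK closed nonisol]].
have KA : K \subset A.
  by apply/fintype.subsetP => u /nonisol[v] /= /andP[/supp].
have : cut x K = 0.
  rewrite /cut big1 // => u uK; apply: big1 => v; rewrite inE => vK.
  apply/le_anti; rewrite x0 andbT leNgt; apply/negP => xuv; move/negP: vK; apply.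
  apply: (closed u) => //=; rewrite xuv /=.
  have [z /= /andP[xuz xuz1]] := nonisol u uK.
  have [<-//|zv] := eqVneq z v; have := fractional_row2 u fx zv; lra.
have := odds K KA oK; lra.
Qed.

(* Edmonds' perfect matching polytope theorem, in support-function form. *)
Theorem polytope_dominated (F : realFieldType) (V : finType) (A : {set V})
    (x : V -> V -> F) : matching_polytope A x -> dominated A x.
Proof.
have [n] := ubnP #|A|; elim: n A x => // n IHA A x leA.
have [m] := ubnP #|[set p : V * V | 0 < x p.1 p.2]%SET|; elim: m x => // m IHx x lex poly.
(* Both sides have more than one vertex, so both contractions are smaller and the induction on
   [#|A|] applies. [z] is kept general because the cut may become tight only after the move. *)
have tight (z : V -> V -> F) S : matching_polytope A z -> nontrivial_odd A S ->
    cut z S = 1 -> dominated A z.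
  move=> polz /and4P[SA oS S1 D1] cS.
  have eA := matching_polytope_even polz.
  have oD : odd #|A :\: S|%SET by rewrite odd_setD.
  have cD : cut z (A :\: S)%SET = 1 by rewrite (cutC polz.1).
  have [s sS] : exists s, s \in S by apply/card_gt0P; apply: ltn_trans S1.
  have [t tD] : exists t, t \in (A :\: S)%SET by apply/card_gt0P; apply: ltn_trans D1.
  have cardA : (#|S| + #|A :\: S|%SET = #|A|)%N.
    by rewrite -(cardsID S A) (finset.setIidPr SA).
  have tS : t \notin S by move: tD; rewrite !inE => /andP[].
  have sD : s \notin (A :\: S)%SET by rewrite !inE sS.
  apply: (tight_cut_dominated polz.1 SA cS sS tD).
    apply: IHA; first by rewrite cardsU1 tS; lia.
    exact: contract_polytope polz SA oS tS cS.
  apply: IHA; first by rewrite cardsU1 sD; lia.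
  exact: contract_polytope polz (finset.subsetDl _ _) oD sD cD.
have [/existsP[S /andP[ntS /eqP cS]]|notight] :=
  boolP [exists S : {set V}, nontrivial_odd A S && (cut x S == 1)].
  exact: tight cS.
have {}notight S : nontrivial_odd A S -> cut x S != 1.
  by move=> ntS; move: notight; rewrite negb_exists => /forallP/(_ S); rewrite ntS.
have [frac|nofrac] := pselect (exists u v, 0 < x u v < 1); last first.
  apply: integral_dominated poly.1 _ => u v; have [x0 _ _ _] := poly.1.
  have [xuv|xuv] := boolP (0 < x u v); last first.
    by left; apply/le_anti; rewrite x0 andbT leNgt.
  by right; rewrite leNgt; apply/negP => xuv1; apply: nofrac; exists u, v; rewrite xuv.
have [y cy rowy] := polytope_balanced_weight poly frac => w.
(* Up to replacing [y] by its negative, moving along [y] does not decrease the objective. *)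
wlog wy : y cy rowy / 0 <= \sum_u \sum_v w u v * y u v.
  have sumN : \sum_u \sum_v w u v * - y u v = - \sum_u \sum_v w u v * y u v.
    rewrite -sumrN; apply: eq_bigr => u _; rewrite -sumrN.
    by apply: eq_bigr => v _; rewrite mulrN.
  move=> W; have [?|neg] := leP 0 (\sum_u \sum_v w u v * y u v); first exact: (W y).
  apply: (W (fun u v => - y u v)).
  - have [ysym ysupp [a [b yab]]] := cy; split=> [u v|u v|]; first by rewrite ysym.
      by rewrite oppr_eq0; apply: ysupp.
    by exists a, b; rewrite oppr_eq0.
  - by move=> u; rewrite sumrN rowy oppr0.
  - by rewrite sumN oppr_ge0 ltW.
have [t [t0 polx']] := polytope_move poly cy rowy notight.
set x' := fun u v => _ in polx' * => block.
have x'supp u v : 0 < x' u v -> 0 < x u v.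
  have [_ ysupp _] := cy; have [x0 _ _ _] := poly.1.
  apply: contraTT => xuv; have y0 : y u v = 0.
    by apply/eqP; apply: contraNT xuv; apply: ysupp.
  by rewrite /x' y0 mulr0 addr0.
have [f mf le] : exists2 f, matching A x' f &
    \sum_u \sum_v w u v * x' u v <= \sum_(v in A) w v (f v).
  case: block => [[a [b [xab x'ab]]]|[S ntS cS]]; last exact: (tight _ _ polx' ntS cS).
  apply: IHx => //; rewrite ltnS in lex; apply: leq_trans lex; apply: proper_card.
  apply/fintype.properP; split.
    by apply/fintype.subsetP => p; rewrite !inE; apply: x'supp.
  by exists (a, b); rewrite !inE //= -/(x' a b) (_ : x' a b = 0) ?ltxx.
exists f.
  apply/matchingP => v vA; have [fv ffv xv] := matchingP _ _ _ mf v vA.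
  by split=> //; apply: x'supp.
apply: le_trans le; rewrite /x'.
have -> : \sum_u \sum_v w u v * (x u v + t * y u v) =
    \sum_u \sum_v w u v * x u v + t * \sum_u \sum_v w u v * y u v.
  rewrite mulr_sumr -big_split; apply: eq_bigr => u _ /=.
  by rewrite mulr_sumr -big_split; apply: eq_bigr => v _ /=; ring.
by rewrite lerDl mulr_ge0.
Qed.

(** * Covering an r-graph by 1-factors *)

Definition parallel (G : graph) (u v : vertex G) : {set edge G} :=
  [set e | ends e == [set u; v]]%SET.

Lemma ends_pair (G : graph) (e : edge G) (u : vertex G) : u \in ends e ->
  exists2 v, v != u & ends e = [set u; v]%SET.
Proof.
have /eqP/cards2P[a [b [ab ->]]] := card_ends e.
rewrite !inE => /orP[]/eqP->; first by exists b; rewrite // eq_sym.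
by exists a; rewrite // finset.setUC.
Qed.

Lemma sum_ends_eq (G : graph) (e : edge G) (u : vertex G) :
  (\sum_v (ends e == [set u; v]%SET) = (u \in ends e))%N.
Proof.
have [/ends_pair[v _ ->]|ue] := boolP (u \in ends e).
  rewrite (bigD1 v) //= eqxx big1 // => z zv; apply/eqP; rewrite eqb0.
  by apply: contra zv => /eqP/set2_inj ->.
by rewrite big1 // => v _; apply/eqP; rewrite eqb0; apply: contra ue => /eqP ->; rewrite set21.
Qed.

Lemma sum_parallel (G : graph) (u : vertex G) (U : {set edge G}) :
  (\sum_v #|parallel u v :&: U|%SET = #|incident u :&: U|%SET)%N.
Proof.
under eq_bigr do rewrite -sum1_card big_mkcond /=.
rewrite exchange_big -sum1_card [RHS]big_mkcond; apply: eq_bigr => e _ /=.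
rewrite !inE; have [eU|eU] := boolP (e \in U).
  rewrite andbT -[RHS]/(nat_of_bool _) -sum_ends_eq.
  by apply: eq_bigr => v _; rewrite !inE eU andbT; case: (_ == _).
by rewrite andbF big1 // => v _; rewrite !inE (negbTE eU) andbF.
Qed.

Lemma sum_incident (G : graph) (U : {set edge G}) :
  (\sum_v #|incident v :&: U|%SET = 2 * #|U|)%N.
Proof.
under eq_bigr do rewrite -sum1_card big_mkcond /=.
rewrite exchange_big mulnC -sum_nat_const [RHS]big_mkcond; apply: eq_bigr => e _ /=.
have [eU|eU] := boolP (e \in U); last first.
  by rewrite big1 // => v _; rewrite !inE (negbTE eU) andbF.
rewrite -(card_ends e) -sum1_card [RHS]big_mkcond; apply: eq_bigr => v _.
by rewrite !inE eU andbT.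
Qed.

(** The constant weight 1/r, summed over parallel edges to fit weights on pairs of vertices. *)
Definition multiplicity (r : nat) (G : graph) (u v : vertex G) : rat :=
  #|parallel u v|%:R / r%:R.

Lemma multiplicity_polytope (r : nat) (G : graph) : (0 < r)%N -> r_graph r G ->
  matching_polytope [set: vertex G]%SET (@multiplicity r G).
Proof.
move=> r0 [reg odds]; have rn0 : r%:R != 0 :> rat by rewrite pnatr_eq0 -lt0n.
split; first split=> [u v|u v|u|u].
- by rewrite /multiplicity divr_ge0 ?ler0n.
- by rewrite /multiplicity /parallel finset.setUC.
- rewrite /multiplicity (_ : parallel u u = finset.set0) ?cards0 ?mul0r //.
  apply/setP => e; rewrite !inE; apply/negbTE/eqP => E.
  by have := card_ends e; rewrite E finset.setUid cards1.
- rewrite -mulr_suml -natr_sum inE.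
  have := sum_parallel u finset.setT; rewrite finset.setIT reg.
  by under eq_bigr do rewrite finset.setIT; move=> ->; rewrite divff.
move=> S _ oS; have := odds S oS; rewrite -(ler_nat rat) => rS.
(* Each boundary edge is counted at the ordered pair of its end in [S] and its end outside. *)
suff : #|boundary S|%:R <= cut (@multiplicity r G) S * r%:R.
  move=> /(le_trans rS); rewrite -[X in X <= _]mul1r ler_pM2r // ltr0n //.
rewrite /cut mulr_suml; under eq_bigr do rewrite mulr_suml.
under eq_bigr do under eq_bigr do rewrite /multiplicity divfK //.
under eq_bigr do rewrite -natr_sum.
rewrite -natr_sum ler_nat -sum1_card.
under [X in (_ <= X)%N]eq_bigr do under eq_bigr do rewrite -sum1_card big_mkcond /=.
under [X in (_ <= X)%N]eq_bigr do rewrite exchange_big.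
rewrite [X in (_ <= X)%N]exchange_big big_mkcond; apply: leq_sum => e _ /=.
case: ifP => //; rewrite inE => /cards1P[u Eu].
have : u \in (ends e :&: S)%SET by rewrite Eu set11.
rewrite inE => /andP[ue uS]; have [v vu Ev] := ends_pair ue.
have vS : v \in (~: S)%SET.
  rewrite inE; apply: contra vu => vS.
  have : v \in (ends e :&: S)%SET by rewrite inE vS Ev set22.
  by rewrite Eu inE.
by rewrite (bigD1 u) //= (bigD1 v) //= !inE Ev eqxx.
Qed.

(** Edmonds' theorem is applied to the indicator [w] of the pairs joined by an edge of [U]. Each
    matched pair is then represented by one of its parallel edges, taken from [U] when possible. *)
Lemma heavy_one_factor (r : nat) (G : graph) (U : {set edge G}) :
  (0 < r)%N -> r_graph r G ->
  exists2 M : {set edge G}, one_factor M & (#|U| <= r * #|M :&: U|%SET)%N.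
Proof.
move=> r0 rG; have poly := multiplicity_polytope r0 rG.
have rn0 : r%:R != 0 :> rat by rewrite pnatr_eq0 -lt0n.
pose w u v := (parallel u v :&: U != finset.set0)%SET.
have [f mf le] := polytope_dominated poly (fun u v => (w u v)%:R).
have fP v := matchingP _ _ _ mf v (finset.in_setT v).
have fK v : f (f v) = v by have [] := fP v.
(* The choice depends on the unordered pair only, so both ends of a matched pair receive the same
   edge. *)
have /choice[c cP] : forall P : {set vertex G}, exists e : option (edge G),
    forall e0, ends e0 = P -> exists e1, [/\ e = Some e1, ends e1 = P &
      forall e2, e2 \in U -> ends e2 = P -> e1 \in U].
  move=> P.
  have [[e1 e1U E1]|noU] := pselect (exists2 e1, e1 \in U & ends e1 = P).
    by exists (Some e1) => _ _; exists e1; split.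
  have [[e0 E0]|no] := pselect (exists e0 : edge G, ends e0 = P).
    exists (Some e0) => _ _; exists e0; split=> // e2 e2U E2.
    by case: noU; exists e2.
  by exists None => e0 E0; case: no; exists e0.
have /choice[m mP] : forall v, exists e, [/\ c [set v; f v]%SET = Some e,
    ends e = [set v; f v]%SET & (w v (f v) -> e \in U)].
  move=> v; have [_ _ xv] := fP v.
  have /card_gt0P[e0] : (0 < #|parallel v (f v)|)%N.
    by rewrite lt0n; apply: contraTneq xv => E; rewrite /multiplicity E mul0r ltxx.
  rewrite inE => /eqP /cP[e1 [-> E1 inU]]; exists e1; split=> //.
  by case/set0Pn => e2; rewrite !inE => /andP[/eqP E2 e2U]; apply: inU E2.
have mf_eq v : m (f v) = m v.
  have [c1 _ _] := mP v; have [c2 _ _] := mP (f v); apply: Some_inj.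
  by rewrite -c1 -c2 fK finset.setUC.
pose M := (m @: [set: vertex G])%SET.
have incM v : (incident v :&: M)%SET = [set m v]%SET.
  apply/setP => e; rewrite !inE; apply/andP/eqP => [[ve /imsetP[z _ E]]|->]; last first.
    by have [_ -> _] := mP v; rewrite set21 imset_f ?inE.
  move: ve; rewrite {}E; have [_ -> _] := mP z.
  by rewrite !inE => /orP[]/eqP->.
exists M; first by apply/forallP => v; rewrite incM cards1.
have wU v : (w v (f v) <= #|incident v :&: (M :&: U)|%SET)%N.
  have [wv|//] := boolP (w v (f v)); have [_ _ /(_ wv) mU] := mP v.
  apply/card_gt0P; exists (m v); rewrite finset.setIA incM.
  by rewrite finset.in_setI set11.
(* Each edge of [U] is seen from both ends, and [r] times the multiplicity counts all edges parallel
   to it. *)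
have lo : (2 * #|U|)%:R <= r%:R * \sum_u \sum_v (w u v)%:R * multiplicity r u v :> rat.
  rewrite -sum_incident; under eq_bigr do rewrite -sum_parallel.
  rewrite natr_sum mulr_sumr; apply: ler_sum => u _.
  rewrite natr_sum mulr_sumr; apply: ler_sum => v _.
  rewrite mulrCA /multiplicity [r%:R * _]mulrC divfK //.
  rewrite /w; case: eqP => [->|_] /=; first by rewrite cards0 mul0r.
  by rewrite mul1r ler_nat; apply/subset_leq_card/finset.subsetIl.
rewrite -(leq_pmul2l (ltn0Sn 1)) -(ler_nat rat); apply: le_trans lo _.
apply: le_trans (ler_wpM2l (ler0n _ _) le) _.
rewrite -natr_sum -natrM ler_nat mulnCA leq_mul2l -sum_incident; apply/orP; right.
rewrite [X in (X <= _)%N](eq_bigl predT) => [|v]; last by rewrite inE.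
by apply: leq_sum => v _; apply: wU.
Qed.

(** Stated without division, for the edges left uncovered. Indexing by [nat] lets the family be
    extended without casting ordinals. *)
Lemma greedy_one_factors (r k : nat) (G : graph) : (0 < r)%N -> r_graph r G ->
  exists2 M : nat -> {set edge G}, forall i, one_factor (M i) &
    (r ^ k * #|~: \bigcup_(i < k) M i|%SET <= r.-1 ^ k * #|edge G|)%N.
Proof.
move=> r0 rG; elim: k => [|k [M ofM IH]].
  have [M0 ofM0 _] := heavy_one_factor finset.setT r0 rG.
  by exists (fun=> M0) => //; rewrite big_ord0 finset.setC0 cardsT.
set U := (~: _)%SET in IH; have [M0 ofM0 leU] := heavy_one_factor U r0 rG.
exists (fun i => if (i < k)%N then M i else M0) => [i|]; first by case: ifP.
rewrite big_ord_recr /= ltnn.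
rewrite (eq_bigr (fun i : 'I_k => M i)) => [|i _]; last by rewrite /= ltn_ord.
rewrite finset.setCU -/U -finset.setDE.
have := cardsID M0 U; rewrite finset.setIC => E.
(* At least [#|U| / r] edges of [U] lie in [M0], so at most the fraction (r-1)/r survives. *)
have step : (r * #|U :\: M0|%SET <= r.-1 * #|U|)%N by nia.
rewrite !expnS -!mulnA mulnCA.
apply: leq_trans (_ : r ^ k * (r.-1 * #|U|) <= _)%N; first by rewrite leq_mul2l step orbT.
by rewrite mulnCA leq_mul2l IH orbT.
Qed.

(** * The bound for each graph and for the infimum *)

Lemma edge_gt0 (r : nat) (G : graph) : (0 < r)%N -> regular r G -> (0 < #|edge G|)%N.
Proof.
move=> r0 reg; have /card_gt0P[v _] := vertex_gt0 G.
by rewrite (leq_trans _ (max_card (mem (incident v)))) // reg.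
Qed.

Lemma cover_ratio_ge (R : realType) (r k : nat) (G : graph) : (0 < r)%N -> r_graph r G ->
  1 - ((r%:R - 1) / r%:R) ^+ k <= cover_ratio R k G.
Proof.
move=> r0 rG; have [M ofM le] := greedy_one_factors k r0 rG.
pose N := [ffun i : 'I_k => M i].
have E0 := edge_gt0 r0 rG.1.
have ofN : [forall i, one_factor (N i)] by apply/forallP => i; rewrite ffunE.
apply: le_trans (le_bigmax_cond _ _ ofN).
under eq_bigr do rewrite ffunE.
set C := (\bigcup_(i < k) M i)%SET in le *.
have <- : (#|edge G| - #|~: C|%SET = #|C|)%N by rewrite -(cardsC C) addnK.
have key : #|~: C|%SET%:R / #|edge G|%:R <= ((r%:R - 1) / r%:R) ^+ k :> R.
  rewrite ler_pdivrMr ?ltr0n // expr_div_n mulrAC ler_pdivlMr ?exprn_gt0 ?ltr0n //.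
  have -> : r%:R - 1 = r.-1%:R :> R by rewrite -subn1 natrB.
  by rewrite -!natrX -!natrM ler_nat mulnC.
rewrite natrB ?max_card // [leRHS]mulrBl divff ?pnatr_eq0 -?lt0n //.
by rewrite lerD2l lerN2.
Qed.

(** Witnesses that the set of ratios is nonempty, which [lb_le_inf] requires. *)
Definition dipole (r : nat) : graph.
Proof.
apply: (@Graph bool 'I_r (fun=> [set: bool]%SET)); first by rewrite card_bool.
by move=> e; rewrite cardsT card_bool.
Defined.

Lemma dipole_r_graph (r : nat) : r_graph r (dipole r).
Proof.
split=> [v|S oS].
  rewrite (_ : incident v = [set: 'I_r]%SET) ?cardsT ?card_ord //.
  by apply/setP => e; rewrite !inE.
rewrite (_ : boundary S = [set: 'I_r]%SET) ?cardsT ?card_ord //.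
apply/setP => e; rewrite !inE finset.setTI.
have := max_card (mem S); rewrite card_bool; move: oS.
by case: #|_| => [|[|[]]].
Qed.

Theorem theorem3p2 (R : realType) (r k : nat) (hr : (3 <= r)%N) (hk : (0 < k)%N) :
  min_cover_ratio R r k >= 1 - ((r%:R - 1) / r%:R) ^+ k.
Proof.
have r0 : (0 < r)%N by apply: ltn_trans hr.
apply: lb_le_inf.
  by exists (cover_ratio R k (dipole r)), (dipole r) => //; apply: dipole_r_graph.
by move=> _ [G rG ->]; apply: cover_ratio_ge.
Qed.
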